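(* Let $A$ be a self-adjoint (possibly unbounded) operator in a complex Hilbert space $\mathcal{H}$ with projection-valued spectral measure $P_A$, and let $$E=\int_{(0,\infty)}\sqrt{x}\,P_A(dx),\qquad F=\int_{(-\infty,0)}\sqrt{-x}\,P_A(dx).$$ Let $\psi\in\mathcal{H}$ be a unit vector. Then: (a) the mean of $A$ in the state $\psi$ exists if and only if $\psi\in\operatorname{dom}E\cap\operatorname{dom}F$, and in that case it equals $\|E(\psi)\|^2-\|F(\psi)\|^2$; (b) the variance of $A$ in the state $\psi$ exists if and only if $\psi\in\operatorname{dom}A$.
   Context: For a unit vector $\psi$, the distribution of the observable $A$ in the state $\psi$ is the Borel probability measure $\mu_\psi(S)=\langle P_A(S)\psi,\psi\rangle=\|P_A(S)\psi\|^2$ on $\mathbb{R}$. The mean of $A$ in the state $\psi$ exists if $x$ is integrable with respect to $\mu_\psi$ (i.e. $\int_{\mathbb{R}}|x|\,\mu_\psi(dx)<\infty$), and is then $\mu=\int_{\mathbb{R}}x\,\mu_\psi(dx)$. The variance of $A$ in the state $\psi$ exists if the mean $\mu$ exists and $\int_{\mathbb{R}}(x-\mu)^2\,\mu_\psi(dx)<\infty$. The operators $E$ and $F$ are self-adjoint operators defined by the Borel functional calculus of $A$: $E=g(A)$ with $g(x)=\sqrt{x}\,1_{(0,\infty)}(x)$ and $F=h(A)$ with $h(x)=\sqrt{-x}\,1_{(-\infty,0)}(x)$; for a Borel function $g$, $\operatorname{dom}g(A)=\{\psi:\int|g|^2\,d\mu_\psi<\infty\}$ (with $\mu_\psi(S)=\|P_A(S)\psi\|^2$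 for any $\psi\in\mathcal H$). *)

(* Defs.v *)
From HB Require Import structures.
From mathcomp Require Import all_boot all_order all_algebra.
From mathcomp Require Import all_classical all_reals all_analysis.
From mathcomp.real_closed Require Import complex.

Set Implicit Arguments.
Unset Strict Implicit.
Unset Printing Implicit Defensive.

Import Order.TTheory GRing.Theory Num.Theory.
Import numFieldNormedType.Exports HBSimple.

Local Open Scope classical_set_scope.
Local Open Scope ring_scope.
Local Open Scope complex_scope.

(* Complex Hilbert spaces. The inner product is linear in its first argument
   and conjugate-linear in the second. *)
HB.mixin Record isHilbert (R : realType) (H : Type)
    of CompleteNormedModule R[i] H := {
  inner : {dot H for Num.conj} ;
  inner_norm : forall x : H, inner x x = `|x| ^+ 2
}.

#[short(type="hilbertType")]
HB.structure Definition Hilbert (R : realType) :=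
  {H of isHilbert R H & CompleteNormedModule R[i] H}.

(* The norm [`|x|] of a normed module over [R[i]] takes its values in [R[i]];
   [hnorm] is the same number in [R]. *)
Definition hnorm (R : realType) (H : hilbertType R) (x : H) : R :=
  complex.Re `|x|.

Section HilbertNorm.
Variables (R : realType) (H : hilbertType R).
Implicit Types x y : H.

Lemma hnormE x : (hnorm x)%:C = `|x|.
Proof. by rewrite /hnorm RRe_real// ger0_real. Qed.

Lemma hnorm_ge0 x : 0 <= hnorm x.
Proof. by rewrite -lecR hnormE; exact: normr_ge0. Qed.

Lemma hnorm_sqrE x : ((hnorm x) ^+ 2)%:C = inner x x.
Proof. by rewrite inner_norm -hnormE rmorphXn. Qed.

Lemma hnorm_distB x y : `|hnorm x - hnorm y| <= hnorm (x - y).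
Proof.
have key (a b : H) : hnorm a - hnorm b <= hnorm (a - b).
  have e : (hnorm a - hnorm b)%:C = `|a| - `|b| by rewrite -!hnormE rmorphB.
  by rewrite -lecR e hnormE; exact: lerB_dist.
rewrite ler_norml key andbT lerNl opprB.
by have := key y x; rewrite {3}/hnorm distrC.
Qed.

Lemma cvg_hnorm (u : H^nat) x :
  u @ \oo --> x -> (fun n => hnorm (u n)) @ \oo --> hnorm x.
Proof.
move=> /cvgrPdist_lt ux; apply/cvgrPdist_lt => e e0.
have /ux : 0 < e%:C by rewrite ltcR.
apply: filterS => n xun; rewrite (le_lt_trans (hnorm_distB _ _))//.
by rewrite -ltcR hnormE.
Qed.

Lemma hnorm_pythagoras x y : inner x y = 0 ->
  hnorm (x + y) ^+ 2 = hnorm x ^+ 2 + hnorm y ^+ 2.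
Proof.
move=> xy0; apply: (@complexI R).
rewrite rmorphD/= !hnorm_sqrE linearDl/= !linearDr/= xy0.
by rewrite [inner y x]hermC/= xy0 rmorph0 mulr0 addr0 add0r.
Qed.

End HilbertNorm.

(* Projection-valued measures on the Borel sets of the real line. The values
   of [pvm_proj] on non-measurable sets are irrelevant. *)
Record pvm (R : realType) (H : hilbertType R) := PVM {
  pvm_proj :> set R -> {linear H -> H} ;
  pvm_idem : forall S, measurable S ->
    forall x, pvm_proj S (pvm_proj S x) = pvm_proj S x ;
  pvm_sym : forall S, measurable S ->
    forall x y, inner (pvm_proj S x) y = inner x (pvm_proj S y) ;
  pvm_set0 : forall x, pvm_proj set0 x = 0 ;
  pvm_setT : forall x, pvm_proj setT x = x ;
  pvm_setI : forall S T, measurable S -> measurable T ->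
    forall x, pvm_proj (S `&` T) x = pvm_proj S (pvm_proj T x) ;
  pvm_bigcup : forall F : (set R)^nat, (forall i, measurable (F i)) ->
    trivIset setT F -> forall x,
    (fun n => \sum_(0 <= i < n) pvm_proj (F i) x) @ \oo -->
      pvm_proj (\bigcup_i F i) x
}.

(* The distribution [mu_psi(S) = ||P(S) psi||^2]; it is made into a measure
   below. *)
Definition spec_dist (R : realType) (H : hilbertType R) (P : pvm H) (psi : H)
  : set R -> \bar R := fun S => (hnorm (P S psi) ^+ 2)%:E.

Section SpecDistMeasure.
Variables (R : realType) (H : hilbertType R) (P : pvm H) (psi : H).

Let mu0 : spec_dist P psi set0 = 0%E.
Proof. by rewrite /spec_dist pvm_set0 /hnorm normr0 expr0n. Qed.

Let mu_ge0 S : (0 <= spec_dist P psi S)%E.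
Proof. by rewrite lee_fin sqr_ge0. Qed.

Let pvm_ortho S T x y : measurable S -> measurable T -> S `&` T = set0 ->
  inner (P S x) (P T y) = 0.
Proof.
move=> mS mT ST0.
by rewrite pvm_sym// -pvm_setI// ST0 pvm_set0 linear0r.
Qed.

Let mu_sigma_additive : semi_sigma_additive (spec_dist P psi).
Proof.
move=> F mF tF _.
have sumE n : (\sum_(0 <= i < n) spec_dist P psi (F i))%E =
    (hnorm (\sum_(0 <= i < n) P (F i) psi) ^+ 2)%:E.
  elim: n => [|n IHn].
    by rewrite !big_nil /hnorm normr0 expr0n.
  rewrite !big_nat_recr//= IHn hnorm_pythagoras//.
  rewrite linear_sumlz big_nat big1// => i /andP[_ ni].
  apply: pvm_ortho => //; move/trivIsetP : tF; apply => //.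
  by rewrite lt_eqF.
under eq_fun do rewrite sumE.
apply: cvg_EFin; first by apply: nearW.
have h := cvg_hnorm (pvm_bigcup (p := P) mF tF (x:=psi)).
by under eq_fun do rewrite /= expr2; rewrite expr2; exact: cvgM.
Qed.

HB.instance Definition _ := isMeasure.Build _ _ _ (spec_dist P psi)
  mu0 mu_ge0 mu_sigma_additive.

End SpecDistMeasure.

Section UnboundedOperators.
Variables (R : realType) (H : hilbertType R).

(* A partially defined map of [H]; the values of [op_fun] outside of [dom] are
   irrelevant, and equality of operators is [op_eq]. *)
Record partial_op := PartialOp { dom : set H ; op_fun :> H -> H }.

Definition op_eq (A B : partial_op) : Prop :=
  dom A = dom B /\ forall x, dom A x -> A x = B x.

Definition linear_op (A : partial_op) : Prop :=
  dom A 0 /\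
  forall (a : R[i]) x y, dom A x -> dom A y ->
    dom A (a *: x + y) /\ A (a *: x + y) = a *: A x + A y.

Definition adjoint_value (A : partial_op) (phi eta : H) : Prop :=
  forall psi, dom A psi -> inner (A psi) phi = inner psi eta.

(* When [A] is densely defined, [adjoint_value A phi] has at most one element,
   so that [xget] returns the value of the adjoint on its domain. *)
Definition adjoint (A : partial_op) : partial_op := {|
  dom := [set phi | exists eta, adjoint_value A phi eta] ;
  op_fun := fun phi => xget 0 [set eta | adjoint_value A phi eta] |}.

Definition selfadjoint (A : partial_op) : Prop :=
  [/\ linear_op A, dense (dom A) & op_eq A (adjoint A)].

End UnboundedOperators.

Section SpectralIntegral.
Variables (R : realType) (H : hilbertType R) (P : pvm H).

(* [sum_c c P(s = c) psi] for a simple function [s] *)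
Definition simple_spec_int (s : {sfun R >-> R}) (psi : H) : H :=
  \sum_(c \in range s) (c%:C *: P (s @^-1` [set c]) psi).

(* [eta] is the limit of the integrals at [psi] of simple functions converging
   to [g] in [L^2(mu_psi)]. By the isometry
   [||simple_spec_int s psi||^2 = \int |s|^2 dmu_psi], such an [eta] is unique,
   and it exists when [g] is Borel and square-integrable. *)
Definition spec_int_value (g : R -> R) (psi eta : H) : Prop :=
  exists s : {sfun R >-> R}^nat,
    ((fun n => \int[spec_dist P psi]_x ((s n x - g x) ^+ 2)%:E)%E @ \oo
       --> 0%E) /\
    ((fun n => simple_spec_int (s n) psi) @ \oo --> eta).

(* The operator [\int g dP], for a real Borel function [g] *)
Definition spec_int (g : R -> R) : partial_op H := {|
  dom := [set psi | (\int[spec_dist P psi]_x (g x ^+ 2)%:E < +oo)%E] ;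
  op_fun := fun psi => xget 0 [set eta | spec_int_value g psi eta] |}.

Definition spectral_measure_of (A : partial_op H) : Prop :=
  op_eq A (spec_int (fun x => x)).

Definition sqrt_pos_part : partial_op H :=
  spec_int (fun x => Num.sqrt x * \1_[set y | 0 < y] x).

Definition sqrt_neg_part : partial_op H :=
  spec_int (fun x => Num.sqrt (- x) * \1_[set y | y < 0] x).

Definition mean_exists (psi : H) : Prop :=
  (spec_dist P psi).-integrable setT (fun x : R => x%:E).

Definition mean (psi : H) : R := (\int[spec_dist P psi]_x x)%R.

Definition variance_exists (psi : H) : Prop :=
  mean_exists psi /\
  (\int[spec_dist P psi]_x ((x - mean psi) ^+ 2)%:E < +oo)%E.

End SpectralIntegral.

(* Main.v *)
From HB Require Import structures.
Require Import Defs.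
From mathcomp Require Import all_boot all_order all_algebra.
From mathcomp Require Import finmap.
From mathcomp Require Import all_classical all_reals all_analysis.
From mathcomp Require Import measurable_realfun.
From mathcomp.real_closed Require Import complex.
From mathcomp Require Import ring lra.

Set Implicit Arguments.
Unset Strict Implicit.
Unset Printing Implicit Defensive.

Import Order.TTheory GRing.Theory Num.Theory.
Import numFieldNormedType.Exports.

Local Open Scope classical_set_scope.
Local Open Scope ring_scope.

(** For simple functions [s], [t] one has
    [<s(A) psi, t(A) psi> = \int s t dmu_psi], since
    [<P(S) psi, P(T) psi> = mu_psi(S `&` T)]. Hence [s |-> s(A) psi] is an isometry
    from simple functions with the [L^2(mu_psi)] norm to [H]; by completeness
    it extends, and [||g(A) psi||^2 = \int g^2 dmu_psi] for every nonnegative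
    [g] in [L^2(mu_psi)]. The squares of the functions defining [E] and [F] are
    the positive and negative parts of [x], which gives (a). Part (b) only uses
    that [mu_psi] is finite, through [x^2 <= 2 (x - m)^2 + 2 m^2] and
    [|x| <= 1 + x^2]. *)

(** * Integrals of simple functions, approximation in L^2, and domination under a finite measure *)

Section Integration.
Import HBSimple.
Variables (disp : measure_display) (T : measurableType disp) (R : realType).

Lemma Rintegral_sum (mu : {measure set T -> \bar R}) I (r : seq I) (f : I -> T -> R) :
  (forall i, mu.-integrable setT (EFin \o f i)) ->
  (\int[mu]_x (\sum_(i <- r) f i x) = \sum_(i <- r) \int[mu]_x f i x)%R.
Proof.
move=> fi; rewrite /Rintegral sum_fine; last first.
  by move=> i _; exact: (integrable_fin_num measurableT (fi i)).
congr fine; rewrite -integral_sum//; apply: eq_integral => x _.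
by rewrite -sumEFin.
Qed.

(** Over joint level sets, the integral of [s * t] matches term by term the expanded inner product
    of two simple spectral integrals. *)
Lemma sfun_mulE (s t : {sfun T >-> R}) x : s x * t x =
  \sum_(c <- fset_set (range s)) \sum_(d <- fset_set (range t))
    c * d * \1_(s @^-1` [set c] `&` t @^-1` [set d]) x.
Proof.
rewrite (fimfunE s) (fimfunE t) !fsbig_finite// mulr_suml.
apply: eq_bigr => c _; rewrite mulr_sumr; apply: eq_bigr => d _.
by rewrite indicI mulrACA.
Qed.

Import HBNNSimple.

(** The standard nonnegative approximations satisfy [0 <= t n <= g], so [g ^+ 2] dominates both
    integrands and dominated convergence gives both limits. The second limit later identifies the
    norm of the spectral integral. *)
Lemma sfun_L2_approx (mu : {measure set T -> \bar R}) (g : T -> R) :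
  measurable_fun setT g -> (forall x, 0 <= g x) ->
  (\int[mu]_x ((g x) ^+ 2)%:E < +oo)%E ->
  exists t : {sfun T >-> R}^nat,
  ((fun n => \int[mu]_x ((t n x - g x) ^+ 2)%:E) @ \oo --> 0)%E /\
  ((fun n => \int[mu]_x ((t n x) ^+ 2)%:E) @ \oo --> \int[mu]_x ((g x) ^+ 2)%:E)%E.
Proof.
move=> mg g0 g2.
have mEg : measurable_fun setT (EFin \o g) by exact/measurable_EFinP.
pose t := nnsfun_approx measurableT mEg.
have t_cvg x : t ^~ x @ \oo --> g x.
  by have /fine_cvgP[] := cvg_nnsfun_approx measurableT mEg (fun x _ => g0 x) (x := x) I.
have t_le n x : t n x <= g x.
  rewrite -lee_fin /t nnsfun_approxE.
  apply: (@le_approx _ _ _ setT (EFin \o g)) => // y _.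
  by rewrite lee_fin.
have t_ge n x : 0 <= t n x by [].
have mt n : measurable_fun setT (t n) by [].
have ig2 : mu.-integrable setT (fun x => ((g x) ^+ 2)%:E).
  apply/integrableP; split.
    by apply/measurable_EFinP; exact: measurable_funX.
  by under eq_integral do rewrite gee0_abs ?lee_fin ?sqr_ge0//.
exists (fun n => t n : {sfun T >-> R}); split.
- have md n : measurable_fun setT (fun x => ((t n x - g x) ^+ 2)%:E).
    by apply/measurable_EFinP; apply: measurable_funX; exact: measurable_funB.
  have d0 x : (fun n => ((t n x - g x) ^+ 2)%:E) @ \oo --> 0%E.
    apply: cvg_EFin; first exact: nearW.
    have z : (fun n => t n x - g x) @ \oo --> (0 : R).
      by rewrite -(subrr (g x)); apply: cvgB => //; exact: cvg_cst.
    by have := cvgM z z; rewrite mulr0; apply.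
  have dg n x : (`|((t n x - g x) ^+ 2)%:E| <= (g x ^+ 2)%:E)%E.
    rewrite gee0_abs ?lee_fin ?sqr_ge0// -sqrrN opprB ler_pXn2r// ?nnegrE ?subr_ge0//.
    by rewrite lerBlDr lerDl.
  have [_ _] := dominated_convergence measurableT md (measurable_cst 0%E)
    (aeW _ (fun x _ => d0 x)) ig2 (aeW _ (fun x n _ => dg n x)).
  by rewrite integral0.
- have md n : measurable_fun setT (fun x => (t n x ^+ 2)%:E).
    by apply/measurable_EFinP; exact: measurable_funX.
  have d0 x : (fun n => (t n x ^+ 2)%:E) @ \oo --> (g x ^+ 2)%:E.
    apply: cvg_EFin; first exact: nearW.
    exact: (cvgM (t_cvg x) (t_cvg x)).
  have dg n x : (`|(t n x ^+ 2)%:E| <= (g x ^+ 2)%:E)%E.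
    by rewrite gee0_abs ?lee_fin ?sqr_ge0// ler_pXn2r// ?nnegrE.
  by have [_ _] := dominated_convergence measurableT md (measurable_int _ ig2)
    (aeW _ (fun x _ => d0 x)) ig2 (aeW _ (fun x n _ => dg n x)).
Qed.

Variable mu : {finite_measure set T -> \bar R}.
Implicit Types s t : {sfun T >-> R}.

Lemma sfun_integrable s : mu.-integrable setT (EFin \o s).
Proof.
apply: measurable_bounded_integrable => //; last exact: simple_bounded.
by rewrite -ge0_fin_numE//; exact: fin_num_measure.
Qed.

Lemma sfun_mul_integrable s t : mu.-integrable setT (fun x => (s x * t x)%:E).
Proof. exact: (sfun_integrable (s * t)). Qed.

Lemma sfun_preimage_integrable s t c d : mu.-integrable setT
  (EFin \o (fun x => c * d * \1_(s @^-1` [set c] `&` t @^-1` [set d]) x)).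
Proof.
have mst := measurableI _ _ (measurable_funPTI s (measurable_set1 c))
  (measurable_funPTI t (measurable_set1 d)).
pose u : {sfun T >-> R} := cst_sfun (c * d) * indic_sfun _ mst.
exact: (sfun_integrable u).
Qed.

Lemma integral_lty_dominated (f h : T -> R) (a b : R) : 0 <= a -> 0 <= b ->
  measurable_fun setT f -> measurable_fun setT h ->
  (forall x, 0 <= f x) -> (forall x, 0 <= h x) ->
  (forall x, f x <= a * h x + b) ->
  (\int[mu]_x (h x)%:E < +oo)%E -> (\int[mu]_x (f x)%:E < +oo)%E.
Proof.
move=> a0 b0 mf mh f0 h0 fh hoo.
have mEh : measurable_fun setT (fun x => (h x)%:E) by exact/measurable_EFinP.
apply: (@le_lt_trans _ _ (\int[mu]_x (a%:E * (h x)%:E + b%:E)))%E.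
  apply: ge0_le_integral => //.
  - by move=> x _; rewrite lee_fin.
  - exact/measurable_EFinP.
  - by apply: emeasurable_funD => //; exact: measurable_funeM.
  - by move=> x _; rewrite -EFinM -EFinD lee_fin.
rewrite ge0_integralD//.
- rewrite ge0_integralZl//; last by move=> x _; rewrite lee_fin.
  rewrite integral_cst// lte_add_pinfty// lte_mul_pinfty//.
  by rewrite -ge0_fin_numE//; exact: fin_num_measure.
- by move=> x _; rewrite mule_ge0// lee_fin.
- exact: measurable_funeM.
Qed.

End Integration.

(** * The isometry on simple functions and its extension to square-integrable functions *)

Section SpectralDistribution.
Import HBSimple.
Variables (R : realType) (H : hilbertType R) (P : pvm H) (psi : H).
Implicit Types s t : {sfun R >-> R}.

Lemma spec_dist_fin : fin_num_fun (spec_dist P psi).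
Proof. by []. Qed.

HB.instance Definition _ :=
  Measure_isFinite.Build _ _ _ (spec_dist P psi) spec_dist_fin.

Let mu : {finite_measure set R -> \bar R} := spec_dist P psi.

(** Symmetry and multiplicativity reduce both sides to the inner product of [psi] with
    [P (S]&[T) psi]; on the right, idempotence removes the repeated projection. *)
Lemma inner_pvm S T : measurable S -> measurable T ->
  inner (P S psi) (P T psi) = (fine (mu (S `&` T)))%:C%C.
Proof.
move=> mS mT; have mST := measurableI _ _ mS mT.
rewrite /= hnorm_sqrE (pvm_sym _ mS) (pvm_sym _ mST).
by rewrite (pvm_idem _ mST) pvm_setI.
Qed.

Lemma inner_simple_spec_int s t :
  inner (simple_spec_int P s psi) (simple_spec_int P t psi) =
  (\int[mu]_x (s x * t x))%:C%C.
Proof.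
rewrite /simple_spec_int !fsbig_finite//.
under eq_Rintegral do rewrite sfun_mulE.
rewrite Rintegral_sum; last first.
  move=> c; rewrite [X in _.-integrable _ X](_ : _ = (fun x =>
      \sum_(d <- fset_set (range t))
        (c * d * \1_(s @^-1` [set c] `&` t @^-1` [set d]) x)%:E)%E).
    by apply: integrable_sum => // d _; exact: sfun_preimage_integrable.
  by apply: funext => x; rewrite /= -sumEFin.
rewrite linear_sumlz rmorph_sum; apply: eq_bigr => c _.
rewrite Rintegral_sum; last by move=> d; exact: sfun_preimage_integrable.
rewrite linear_sumr rmorph_sum; apply: eq_bigr => d _.
have ms := measurable_funPTI s (measurable_set1 c).
have mt := measurable_funPTI t (measurable_set1 d).
have mst := measurableI _ _ ms mt.
(* The coefficients are real, so conjugate-linearity in the second argument leaves them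
   unchanged. *)
rewrite linearZl_LR linearZr_LR/= inner_pvm// conj_Creal ?complex_real//.
rewrite RintegralZl//; last exact: (sfun_integrable mu (indic_sfun _ mst)).
rewrite /Rintegral integral_indic// setIT.
by rewrite !rmorphM mulrA.
Qed.

Lemma hnorm_simple_spec_int s :
  ((hnorm (simple_spec_int P s psi) ^+ 2)%:E = \int[mu]_x (s x ^+ 2)%:E)%E.
Proof.
rewrite -[RHS]fineK; last first.
  apply: (integrable_fin_num measurableT); exact: (sfun_integrable mu (s * s)).
congr EFin; apply: (@complexI R).
by rewrite hnorm_sqrE inner_simple_spec_int.
Qed.

(** Expanding the inner product of the difference avoids proving that [simple_spec_int] is additive
    in the function, which would require comparing the level sets of [s], [t] and [s - t]. *)
Lemma hnorm_simple_spec_int_sub s t :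
  ((hnorm (simple_spec_int P s psi - simple_spec_int P t psi) ^+ 2)%:E =
  \int[mu]_x ((s x - t x) ^+ 2)%:E)%E.
Proof.
have ist := sfun_mul_integrable mu.
have iB (a b c d : {sfun R >-> R}) :
    mu.-integrable setT (EFin \o (fun x => a x * b x - c x * d x)%R).
  exact: (integrableB measurableT (ist a b) (ist c d)).
rewrite -[RHS]fineK; last first.
  apply: (integrable_fin_num measurableT).
  exact: (sfun_integrable mu ((s - t) * (s - t))).
congr EFin; apply: (@complexI R).
rewrite hnorm_sqrE linearBl/= !linearBr/= !inner_simple_spec_int.
rewrite -!rmorphB; congr (_%:C)%C; rewrite -/(Rintegral _ _ _).
under [RHS]eq_Rintegral do rewrite expr2 mulrBl !mulrBr.
by rewrite !RintegralB//; exact: ist.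
Qed.

(** Integrated form of [(s - t)^2 <= 2 (s - g)^2 + 2 (t - g)^2]; it replaces the triangle inequality
    in L^2 in the Cauchy and uniqueness arguments. *)
Lemma hnorm_simple_spec_int_le s t (g : R -> R) : measurable_fun setT g ->
  ((hnorm (simple_spec_int P s psi - simple_spec_int P t psi) ^+ 2)%:E <=
   2%:E * \int[mu]_x ((s x - g x) ^+ 2)%:E +
   2%:E * \int[mu]_x ((t x - g x) ^+ 2)%:E)%E.
Proof.
move=> mg; rewrite hnorm_simple_spec_int_sub.
have m (u : {sfun R >-> R}) : measurable_fun setT (fun x => ((u x - g x) ^+ 2)%:E).
  apply/measurable_EFinP; apply: measurable_funX; exact: measurable_funB.
have ge0 (u : {sfun R >-> R}) x : (0 <= ((u x - g x) ^+ 2)%:E)%E.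
  by rewrite lee_fin sqr_ge0.
have mZ (u : {sfun R >-> R}) :
    measurable_fun setT (fun x => 2%:E * ((u x - g x) ^+ 2)%:E)%E.
  exact: measurable_funeM.
have Zge0 (u : {sfun R >-> R}) x : (0 <= 2%:E * ((u x - g x) ^+ 2)%:E)%E.
  by rewrite mule_ge0// lee_fin.
rewrite -!ge0_integralZl// -ge0_integralD//.
apply: ge0_le_integral => //.
- by move=> x _; rewrite lee_fin sqr_ge0.
- apply/measurable_EFinP; apply: measurable_funX; exact: measurable_funB.
- exact: emeasurable_funD.
- move=> x _; rewrite -!EFinM -EFinD lee_fin.
  rewrite -subr_ge0 (_ : _ - _ = (s x + t x - 2 * g x) ^+ 2) ?sqr_ge0//; ring.
Qed.

Lemma simple_spec_int_sub_cvg0 (s t : {sfun R >-> R}^nat) (g : R -> R) :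
  measurable_fun setT g ->
  ((fun n => \int[mu]_x ((s n x - g x) ^+ 2)%:E) @ \oo --> 0)%E ->
  ((fun n => \int[mu]_x ((t n x - g x) ^+ 2)%:E) @ \oo --> 0)%E ->
  (fun n => hnorm (simple_spec_int P (s n) psi - simple_spec_int P (t n) psi) ^+ 2)
    @ \oo --> (0 : R).
Proof.
move=> mg s0 t0.
(* The squeeze is done in [\bar R], because finitely many of the bounding integrals may be
   infinite. *)
suff /fine_cvgP[_] : (fun n => (hnorm (simple_spec_int P (s n) psi -
    simple_spec_int P (t n) psi) ^+ 2)%:E) @ \oo --> (0 : R)%:E by [].
apply: (@squeeze_cvge _ _ _ _ (cst 0%E) _ (fun n =>
  2%:E * \int[mu]_x ((s n x - g x) ^+ 2)%:E +
  2%:E * \int[mu]_x ((t n x - g x) ^+ 2)%:E)%E).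
- apply: nearW => n.
  by rewrite hnorm_simple_spec_int_le// andbT lee_fin sqr_ge0.
- exact: cvg_cst.
- have Z (v : (\bar R)^nat) : v @ \oo --> 0%E -> (fun n => 2%:E * v n)%E @ \oo --> 0%E.
    by move=> v0; rewrite -(mule0 2%:E); exact: cvgeZl.
  have d0 : ((0 : \bar R) +? 0)%E by [].
  by have := cvgeD d0 (Z _ s0) (Z _ t0); rewrite adde0; apply.
Qed.

(** The squared distance between two approximating sequences tends both to [hnorm (x - y) ^+ 2] and
    to 0. This makes the choice by [xget] in [spec_int] unambiguous. *)
Lemma spec_int_value_unique (g : R -> R) (x y : H) : measurable_fun setT g ->
  spec_int_value P g psi x -> spec_int_value P g psi y -> x = y.
Proof.
move=> mg [s [s0 sx]] [t [t0 ty]]; apply/eqP; rewrite -subr_eq0 -normr_eq0 -hnormE.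
have h : (fun n => hnorm (simple_spec_int P (s n) psi - simple_spec_int P (t n) psi))
    @ \oo --> hnorm (x - y).
  by apply: cvg_hnorm; exact: cvgB.
have h2 : (fun n => hnorm (simple_spec_int P (s n) psi - simple_spec_int P (t n) psi) ^+ 2)
    @ \oo --> hnorm (x - y) ^+ 2.
  by rewrite expr2; under eq_fun do rewrite expr2; exact: cvgM.
have h3 := simple_spec_int_sub_cvg0 mg s0 t0.
have /eqP : hnorm (x - y) ^+ 2 = 0 by exact: cvg_unique h2 h3.
by rewrite sqrf_eq0 => /eqP ->.
Qed.

Lemma simple_spec_int_cvg (s : {sfun R >-> R}^nat) (g : R -> R) :
  measurable_fun setT g ->
  ((fun n => \int[mu]_x ((s n x - g x) ^+ 2)%:E) @ \oo --> 0)%E ->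
  cvg ((fun n => simple_spec_int P (s n) psi) @ \oo).
Proof.
move=> mg s0; apply: cauchy_cvg; apply: cauchy_exP => e e0.
(* The radius [e] lives in [R[i]]; being positive it is real, so estimates can be made in [R]. *)
have er : (complex.Re e)%:C%C = e by rewrite RRe_real// gtr0_real.
have r0 : 0 < complex.Re e by rewrite -ltcR er.
set r := complex.Re e in er r0.
(* With both integrals below [r ^+ 2 / 4], the two factors 2 in the bound add up to [r ^+ 2]. *)
have [N _ sN] : \forall n \near \oo,
    (\int[mu]_x ((s n x - g x) ^+ 2)%:E < (r ^+ 2 / 4)%:E)%E.
  have /fine_cvgP[sfin /cvgr_lt/(_ (r ^+ 2 / 4))] := s0.
  rewrite divr_gt0 ?exprn_gt0// => /(_ isT); apply: filterS2 sfin => n sfin.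
  by rewrite -lte_fin fineK.
exists (simple_spec_int P (s N) psi); exists N => // n Nn /=.
rewrite -ball_normE /= -hnormE -er ltcR.
rewrite -(@ltr_pXn2r _ 2)// ?nnegrE ?hnorm_ge0 ?(ltW r0)//.
rewrite -lte_fin (le_lt_trans (hnorm_simple_spec_int_le _ _ mg))//.
rewrite [X in (_ < X)%E](_ : _ =
  2%:E * (r ^+ 2 / 4)%:E + 2%:E * (r ^+ 2 / 4)%:E)%E; last first.
  by rewrite -!EFinM -EFinD; congr EFin; field.
by apply: lteD; rewrite lte_pmul2l//; apply: sN => /=.
Qed.

(** Completeness of [H] gives the limit; its norm follows because the squared norms of the
    approximants tend to [hnorm eta ^+ 2] and, by the isometry, to the integral of [g ^+ 2]. *)
Lemma spec_int_value_exists (g : R -> R) :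
  measurable_fun setT g -> (forall x, 0 <= g x) ->
  (\int[mu]_x ((g x) ^+ 2)%:E < +oo)%E ->
  exists eta, spec_int_value P g psi eta /\
    ((hnorm eta ^+ 2)%:E = \int[mu]_x ((g x) ^+ 2)%:E)%E.
Proof.
move=> mg g0 g2; have [t [tg t2]] := sfun_L2_approx mg g0 g2.
have /cvg_ex[eta te] := simple_spec_int_cvg mg tg.
exists eta; split; first by exists t.
have nt : (fun n => (hnorm (simple_spec_int P (t n) psi) ^+ 2)%:E) @ \oo -->
    (hnorm eta ^+ 2)%:E.
  apply: cvg_EFin; first exact: nearW.
  by have h := cvg_hnorm te; exact: (cvgM h h).
move: t2; under eq_fun do rewrite -hnorm_simple_spec_int.
exact: cvg_unique nt.
Qed.

Lemma hnorm_spec_int (g : R -> R) :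
  measurable_fun setT g -> (forall x, 0 <= g x) ->
  dom (spec_int P g) psi ->
  ((hnorm (spec_int P g psi) ^+ 2)%:E = \int[mu]_x ((g x) ^+ 2)%:E)%E.
Proof.
move=> mg g0 g2; have [eta [etav <-]] := spec_int_value_exists mg g0 g2.
congr ((hnorm _ ^+ 2)%:E) => /=.
(* The default value of [xget] is excluded by the existence of [eta]. *)
case: xgetP => [y -> /= yv|/(_ eta)//].
exact: (spec_int_value_unique mg).
Qed.

End SpectralDistribution.

(** * The mean through the positive and negative parts of the identity *)

Section Moments.
Import HBSimple.
Variables (R : realType) (H : hilbertType R) (P : pvm H) (psi : H).
Let mu : {measure set R -> \bar R} := spec_dist P psi.

Lemma sqr_sqrt_pos_part (x : R) :
  (Num.sqrt x * \1_[set y | 0 < y] x) ^+ 2 = Num.max x 0.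
Proof.
rewrite indicE; case: (ltP 0 x) => x0.
  by rewrite mem_set// mulr1 sqr_sqrtr// ltW.
by rewrite memNset ?mulr0 ?expr0n//= ltNge x0.
Qed.

Lemma sqr_sqrt_neg_part (x : R) :
  (Num.sqrt (- x) * \1_[set y | y < 0] x) ^+ 2 = Num.max (- x) 0.
Proof.
rewrite indicE; case: (ltP 0 (- x)) => x0.
  by rewrite mem_set ?mulr1 ?sqr_sqrtr ?(ltW x0)//= -oppr_gt0.
by rewrite memNset ?mulr0 ?expr0n//= -oppr_gt0 ltNge x0.
Qed.

Let id_pos : ((EFin : R -> \bar R)^\+ = (fun x => (Num.max x 0)%:E))%E.
Proof. by apply/funext => x; rewrite funeposE -EFin_max. Qed.

Let id_neg : ((EFin : R -> \bar R)^\- = (fun x => (Num.max (- x) 0)%:E))%E.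
Proof. by apply/funext => x; rewrite funenegE -EFin_max. Qed.

Let mid : measurable_fun setT (EFin : R -> \bar R).
Proof. exact/measurable_EFinP. Qed.

(** The integral of [|x|] is the sum of those of the positive and negative parts; both are
    nonnegative, so the sum is finite exactly when each term is. *)
Lemma mean_existsP :
  mean_exists P psi <-> (dom (sqrt_pos_part P) `&` dom (sqrt_neg_part P)) psi.
Proof.
rewrite /mean_exists /= /setI/=.
under eq_integral do rewrite sqr_sqrt_pos_part.
under [X in _ <-> (_ /\ (X < _)%E)]eq_integral do rewrite sqr_sqrt_neg_part.
rewrite -id_pos -id_neg.
have absE : (\int[mu]_x `|x%:E| = \int[mu]_x (EFin^\+ x) + \int[mu]_x (EFin^\- x))%E.
  rewrite -ge0_integralD//; last 2 first.
  - exact: measurable_funepos.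
  - exact: measurable_funeneg.
  by apply: eq_integral => x _; have /(congr1 (@^~ x)) := fune_abse (EFin : R -> \bar R).
have p0 : (0 <= \int[mu]_x (EFin^\+ x))%E by apply: integral_ge0.
have n0 : (0 <= \int[mu]_x (EFin^\- x))%E by apply: integral_ge0.
split.
  move=> /integrableP[_]; rewrite absE => h; split; apply: le_lt_trans h.
    by rewrite leeDl.
  by rewrite leeDr.
move=> [p n]; apply/integrableP; split=> //.
by rewrite absE lte_add_pinfty.
Qed.

Lemma meanE : mean_exists P psi ->
  mean P psi = hnorm (sqrt_pos_part P psi) ^+ 2 - hnorm (sqrt_neg_part P psi) ^+ 2.
Proof.
move=> me; have [dE dF] := mean_existsP.1 me.
have msqrt : measurable_fun setT (@Num.sqrt R).
  by apply: continuous_measurable_fun; exact: sqrt_continuous.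
have mE : measurable_fun setT (fun x : R => Num.sqrt x * \1_[set y | 0 < y] x).
  apply: measurable_funM => //; apply: measurable_indic.
  rewrite (_ : [set y | 0 < y] = `]0, +oo[%classic); first exact: measurable_itv.
  by apply/seteqP; split=> y /=; rewrite in_itv/= andbT.
have mF : measurable_fun setT (fun x : R => Num.sqrt (- x) * \1_[set y | y < 0] x).
  apply: measurable_funM; first exact: measurableT_comp.
  apply: measurable_indic.
  rewrite (_ : [set y | y < 0] = `]-oo, 0[%classic); first exact: measurable_itv.
  by apply/seteqP; split=> y /=; rewrite in_itv/=.
have ge0 (A : R -> R) (B : set R) x : 0 <= Num.sqrt (A x) * \1_B x.
  by rewrite mulr_ge0// sqrtr_ge0.
have := hnorm_spec_int mE (ge0 _ _) dE; have := hnorm_spec_int mF (ge0 _ _) dF.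
under eq_integral do rewrite sqr_sqrt_neg_part.
move=> hF; under eq_integral do rewrite sqr_sqrt_pos_part.
(* The integral is by definition that of the positive part minus that of the negative part; both are
   now real numbers, so [fine] returns their difference. *)
by move=> hE; rewrite /mean /Rintegral integralE id_pos id_neg -hE -hF.
Qed.

End Moments.

(** The centre [m] is arbitrary, so the mean can be substituted without computing it. *)
Lemma square_integrable_centered (R : realType)
    (nu : {finite_measure set R -> \bar R}) (m : R) :
  nu.-integrable setT (EFin : R -> \bar R) /\
  (\int[nu]_x ((x - m) ^+ 2)%:E < +oo)%E <-> (\int[nu]_x (x ^+ 2)%:E < +oo)%E.
Proof.
have mX : measurable_fun setT (fun x : R => x ^+ 2) by exact: measurable_funX.
have mB : measurable_fun setT (fun x : R => (x - m) ^+ 2).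
  by apply: measurable_funX; exact: measurable_funB.
have m2 : 0 <= 2 * m ^+ 2 by rewrite mulr_ge0 ?sqr_ge0.
split=> [[_]|x2].
  apply: (@integral_lty_dominated _ _ _ _ _ _ 2 (2 * m ^+ 2)) => // x; rewrite ?sqr_ge0//.
  rewrite -subr_ge0 (_ : _ - _ = (x - 2 * m) ^+ 2) ?sqr_ge0//; ring.
split.
  apply/integrableP; split; first exact/measurable_EFinP.
  apply: (@integral_lty_dominated _ _ _ _ (fun x : R => `|x|) _ 1 1) x2 => // x.
    by rewrite sqr_ge0.
  rewrite -real_normK ?num_real//.
  (* The square gives [2 |x| <= x^2 + 1], which is stronger than needed since [|x| >= 0]. *)
  have := sqr_ge0 (`|x| - 1); have := normr_ge0 x; nra.
(* Here the bound is [(x - m)^2 <= 2 x^2 + 2 m^2], with gap [(x + m)^2]. *)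
apply: (@integral_lty_dominated _ _ _ _ _ _ 2 (2 * m ^+ 2)) x2 => // x; rewrite ?sqr_ge0//.
rewrite -subr_ge0 (_ : _ - _ = (x + m) ^+ 2) ?sqr_ge0//; ring.
Qed.

Theorem mainTheorem3 (R : realType) (H : hilbertType R)
    (A : partial_op H) (P : pvm H) (psi : H) :
  selfadjoint A ->
  spectral_measure_of P A ->
  `|psi| = 1 ->
  let E := sqrt_pos_part P in
  let F := sqrt_neg_part P in
  ((mean_exists P psi <-> (dom E `&` dom F) psi) /\
   (mean_exists P psi -> mean P psi = hnorm (E psi) ^+ 2 - hnorm (F psi) ^+ 2))
  /\
  (variance_exists P psi <-> dom A psi).
Proof.
move=> _ [domA _] _ E F; split; last first.
  (* The spectral theorem hypothesis turns [dom A] into finiteness of the second moment, and the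
     centre is taken to be [mean P psi]. *)
  by rewrite domA; exact: square_integrable_centered.
by split; [exact: mean_existsP|exact: meanE].
Qed.
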